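(* Let $t>0$. For every $n\ge 2$, the polynomial in $x$ $$h_n(x;t)=\sum_{d=1}^{n-1}\sum_{i=1}^{d}\binom{n-i-1}{d-i}\binom{n-d-1}{i-1}\,t^i x^d$$ has only real zeros.
   Context: Binomial coefficients $\binom{m}{k}$ are $0$ when $k>m$ or $k<0$. $h_n(x;t)$ is the generating function $\sum_{d=1}^{n-1}g_{U_{n,d}}(t)x^d$ of Speyer's $g$-polynomials of the uniform matroids $U_{n,d}$. *)

(* Defs.v *)
From HB Require Import structures.
From mathcomp Require Import all_boot all_order all_algebra.
From mathcomp Require Import reals.
From mathcomp Require Import complex.

Set Implicit Arguments.
Unset Strict Implicit.
Unset Printing Implicit Defensive.

Import Order.TTheory GRing.Theory Num.Theory.

Local Open Scope ring_scope.

(* The truncated subtractions below are all exact: 1 <= i <= d <= n - 1. *)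
Definition h (R : realType) (n : nat) (t : R) : {poly R} :=
  \sum_(1 <= d < n) \sum_(1 <= i < d.+1)
    (('C(n - i - 1, d - i) * 'C(n - d - 1, i - 1))%:R * t ^+ i) *: 'X^d.

Definition only_real_zeros (R : realType) (p : {poly R}) : Prop :=
  forall z : R[i], root (map_poly (real_complex R) p) z -> complex.Im z = 0.

(* Main.v *)
Require Import Defs.
From HB Require Import structures.
From mathcomp Require Import all_boot all_order all_algebra.
From mathcomp Require Import reals.
From mathcomp Require Import complex.
From mathcomp Require Import zify ring lra.

Import Order.TTheory GRing.Theory Num.Theory.

Local Open Scope ring_scope.

(** Trinomial revision and the binomial theorem turn [h_n(x;t)] into
    [t x F_(n-2)], where [F_N = \sum_k 'C(N-k,k) (tx)^k (1+x)^(N-2k)] obeys the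
    Lucas recurrence [F_(N+2) = (1+x) F_(N+1) + t x F_N].  If [a], [b] are the
    roots of [y^2 - (1+x) y - t x], then [(a - b) F_N = a^(N+1) - b^(N+1)], so a
    zero [x] of [F_N] satisfies [|a| = |b|].  Then
    [(a + b) |a|^2 = a b (a + b)^*], that is,
    [(1 + x) |a|^2 = - t x (1 + x)^*]; the imaginary part of this equation is
    [Im x * |a|^2 = - t * Im x], which forces [Im x = 0]. *)

(** For [k.*2 > N] the binomial is zero, so the truncation in [N - k.*2] is harmless. *)
Definition lucas {A : comNzRingType} (q s : A) (N : nat) : A :=
  \sum_(k < N.+1) 'C(N - k, k)%:R * q ^+ k * s ^+ (N - k.*2).

Lemma lucasSS (A : comNzRingType) (q s : A) (N : nat) :
  lucas q s N.+2 = s * lucas q s N.+1 + q * lucas q s N.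
Proof.
rewrite /lucas big_ord_recl [X in _ = s * X + _]big_ord_recl.
rewrite big_ord_recr [X in _ + (_ + X) = _](_ : _ = 0) ?addr0; last first.
  by rewrite bin_small ?mul0r //= /bump; lia.
rewrite mulrDr -addrA; congr (_ + _).
  by rewrite /= !bin0 !expr0 !mul1r double0 !subn0 exprS.
rewrite !mulr_sumr -big_split; apply: eq_bigr => -[k /= ltk] _.
rewrite /bump /= !add1n (_ : N.+2 - k.+1 = (N - k).+1)%N; last by lia.
rewrite subSS binS natrD (_ : N.+2 - k.+1.*2 = N - k.*2)%N; last by lia.
(* When [N <= k.*2] the truncated powers of [s] no longer match, but ['C(N - k, k.+1)] is zero. *)
have [le2k|gt2k] := leqP k.*2.+1 N.
  rewrite (_ : N - k.*2 = (N.+1 - k.+1.*2).+1)%N; last by lia.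
  by rewrite !exprS; ring.
by rewrite (@bin_small (N - k) k.+1) ?exprS; [ring | lia].
Qed.

(** Both [a] and [b] are roots of [y^2 - (a + b) y + a b], so the right side obeys the recurrence of
    [lucasSS]. Keeping [a - b] as a factor allows [a = b]. *)
Lemma lucas_roots (A : comNzRingType) (a b : A) (N : nat) :
  (a - b) * lucas (- (a * b)) (a + b) N = a ^+ N.+1 - b ^+ N.+1.
Proof.
elim/ltn_ind: N => -[|[|N]] IH.
- by rewrite /lucas big_ord1 /= bin0 !expr0 !expr1 !mulr1.
- by rewrite /lucas !big_ord_recl big_ord0 /= /bump /= bin0 bin_small //; ring.
rewrite lucasSS mulrDr mulrCA (IH N.+1) // [X in _ + X]mulrCA (IH N) //.
by rewrite !exprS; ring.
Qed.

(** If [d + k <= N], both sides are [(N-k)! / (k! (d-k)! (N-d-k)!)]; otherwise both vanish. *)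
Lemma mul_bin_trinomial (N k d : nat) : (k <= d <= N)%N ->
  ('C(N - k, d - k) * 'C(N - d, k) = 'C(N - k, k) * 'C(N - k.*2, d - k))%N.
Proof.
move=> /andP[kd dN].
have [dk|dk] := leqP (d + k) N; last first.
  rewrite (@bin_small (N - d)) ?muln0; last by lia.
  (* If [k.*2 > N], the truncated [N - k.*2] is 0 and its binomial may be 1; here ['C(N - k, k)]
     vanishes instead. *)
  have [k2|k2] := leqP k.*2 N; first by rewrite (@bin_small (N - k.*2)) ?muln0 //; lia.
  by rewrite (@bin_small (N - k)) ?mul0n //; lia.
have E1 := @bin_fact (N - k) (d - k) ltac:(lia).
have E2 := @bin_fact (N - d) k ltac:(lia).
have E3 := @bin_fact (N - k) k ltac:(lia).
have E4 := @bin_fact (N - k.*2) (d - k) ltac:(lia).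
rewrite (_ : N - k - (d - k) = N - d)%N in E1; last by lia.
rewrite (_ : N - k - k = N - k.*2)%N in E3; last by lia.
rewrite (_ : N - k.*2 - (d - k) = N - d - k)%N in E4; last by lia.
move: (fact_gt0 k) (fact_gt0 (d - k)) (fact_gt0 (N - d - k)) => f1 f2 f3.
apply/eqP.
rewrite -(@eqn_pmul2r (k`! * (d - k)`! * (N - d - k)`!)) ?muln_gt0 ?f1 ?f2 //.
apply/eqP; transitivity (N - k)`!.
  by rewrite -E1 -E2; ring.
by rewrite -E3 -E4; ring.
Qed.

Lemma binomial_sum_lucas (A : comNzRingType) (t x : A) (N : nat) :
  \sum_(1 <= d < N.+2) \sum_(1 <= i < d.+1)
    ('C(N.+2 - i - 1, d - i) * 'C(N.+2 - d - 1, i - 1))%:R * t ^+ i * x ^+ d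
  = t * x * lucas (t * x) (1 + x) N.
Proof.
(* Shift [d] and [i] down by one and pad the inner range to one independent of [d], ready for
   exchanging the sums. *)
transitivity (\sum_(0 <= d < N.+1) \sum_(0 <= k < N.+1 | (k <= d)%N)
    t * x * (('C(N - k, k) * 'C(N - k.*2, d - k))%:R * (t * x) ^+ k * x ^+ (d - k))).
  rewrite big_add1 /= !big_nat; apply: eq_bigr => d /andP[_ dN].
  rewrite big_add1 /= (big_nat_widen _ d.+1 N.+1) //.
  apply: eq_bigr => k; rewrite /= ltnS => kd.
  rewrite (_ : N.+2 - k.+1 - 1 = N - k)%N; last by lia.
  rewrite (_ : N.+2 - d.+1 - 1 = N - d)%N; last by lia.
  rewrite !subSS subn0 mul_bin_trinomial ?kd //.
  by rewrite -{2}(subnK kd) exprMn !exprS exprD; ring.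
rewrite (exchange_big_dep xpredT) //= /lucas mulr_sumr big_mkord.
apply: eq_bigr => -[k /= kN] _.
rewrite -mulr_sumr; congr (_ * _).
have [k2|k2] := leqP k.*2 N; last first.
  have -> : 'C(N - k, k) = 0%N by apply: bin_small; lia.
  by rewrite big1 => [|d _]; rewrite ?mul0n !mul0r.
(* The binomial theorem in the index [d - k]; summands with [d > N - k] vanish. *)
rewrite addrC exprD1n mulr_sumr -(big_nat_widenl k 0 N.+1 xpredT) //.
rewrite -{1}[k]add0n big_addn (@big_cat_nat _ _ _ (N - k.*2).+1) //=; last by lia.
rewrite [X in _ + X]big_nat [X in _ + X]big1 ?addr0 => [|i /andP[ki _]]; last first.
  by rewrite addnK (@bin_small (N - k.*2)) // muln0 !mul0r.
rewrite big_mkord; apply: eq_bigr => i _.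
by rewrite addnK natrM; ring.
Qed.

Lemma sum_prod_eq (F : closedFieldType) (s p : F) :
  exists a b : F, a + b = s /\ a * b = p.
Proof.
(* These coefficients encode [a^2 = s a - p]; the other root is then [s - a]. *)
have [a Ea] := @solve_monicpoly F 2 (fun k => if k == 0 then - p else s) isT.
move: Ea; rewrite !big_ord_recl big_ord0 /= expr0 expr1 mulr1 addr0 => Ea.
exists a, (s - a); split; first by ring.
by rewrite mulrBr -expr2 Ea; ring.
Qed.

Lemma Im_eq0_of_norm_eq (R : rcfType) (t : R) (z a b : R[i]) :
  0 < t -> a + b = 1 + z -> a * b = - (real_complex R t * z) -> `|a| = `|b| ->
  complex.Im z = 0.
Proof.
move=> t0 Es Ep En.
have E : (1 + z) * `|a| ^+ 2 = - (real_complex R t * z) * (1 + z)^*.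
  by rewrite -Es -Ep rmorphD /= mulrDl {1}En !normCK; ring.
case: z Es Ep E => u v _ _; rewrite -add_Re2_Im2.
set r := _ ^+ 2 + _ ^+ 2 => E.
have r0 : 0 <= r by rewrite addr_ge0 ?sqr_ge0.
have {E} := congr1 (@complex.Im R) E; rewrite /= => E.
(* The [u v] terms cancel, leaving [v r = - t v]. *)
have : (r + t) * v = 0 by clearbody r; lra.
by move/eqP; rewrite mulf_eq0 gt_eqF /= => [/eqP //|]; rewrite ltr_wpDl.
Qed.

Theorem theorem3p1 (R : realType) (t : R) (ht : 0 < t) (n : nat) (hn : (2 <= n)%N) :
  only_real_zeros (h n t).
Proof.
case: n hn => [|[|N]] // _ z.
have hE : (map_poly (real_complex R) (h N.+2 t)).[z] =
    real_complex R t * z * lucas (real_complex R t * z) (1 + z) N.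
  rewrite -binomial_sum_lucas /h rmorph_sum horner_sum; apply: eq_bigr => d _.
  rewrite rmorph_sum horner_sum; apply: eq_bigr => i _.
  by rewrite /= map_polyZ /= map_polyXn hornerZ hornerXn rmorphM rmorph_nat rmorphXn.
rewrite /root hE mulf_eq0 => /orP[|/eqP F0].
  by rewrite mulf_eq0 fmorph_eq0 gt_eqF //= => /eqP->.
have [a [b [Es Ep]]] := sum_prod_eq _ (1 + z) (- (real_complex R t * z)).
apply: (Im_eq0_of_norm_eq _ _ _ _ _ ht Es Ep).
(* This yields [a ^+ N.+1 = b ^+ N.+1]; norms are nonnegative, so they have equal bases. *)
have := lucas_roots _ a b N; rewrite Ep opprK Es F0 mulr0 => /esym/eqP.
rewrite subr_eq0 => /eqP/(congr1 Num.norm); rewrite !normrX => /eqP.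
by rewrite eqrXn2 // => /eqP.
Qed.
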